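(* Let $G,H$ be finite groups, let $r_G$ and $r_H$ be the ranks over $\mathbb{Q}$ of their commuting difference lattices, and let $d_1\mid\cdots\mid d_{r_G}$ and $e_1\mid\cdots\mid e_{r_H}$ be the full invariant factor lists of the commuting difference lattices of $G$ and $H$ respectively, including any factors equal to $1$. Then the commuting difference lattice of $G\times H$ admits a diagonal presentation with entries $$d_i\ (1\le i\le r_G),\qquad e_j\ (1\le j\le r_H),\qquad d_ie_j\ (1\le i\le r_G,\ 1\le j\le r_H),$$ whose nontrivial entries form the multiset $$\{d_i:d_i>1\}\sqcup\{e_j:e_j>1\}\sqcup\{d_ie_j:d_ie_j>1\}.$$ Consequently the torsion of the cokernel, hence the Smith spectrum, of $G\times H$ is obtained from this multiset by the canonical regrouping of a diagonal matrix into invariant factors (prime-wise collection of elementary divisors), and in particular $$C_{\mathrm{comm}}(G\times H)=C_{\mathrm{comm}}(G)\cup C_{\mathrm{comm}}(H).$$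
   Context: Commuting difference lattice: for a finite group $G$ let $P$ be the $G\times G$ zero-one matrix with $P_{g,h}=1$ if $gh=hg$ and $P_{g,h}=0$ otherwise. Then $M_{\mathrm{comm}}(G)\subseteq\mathbb{Z}^{G}$ is the $\mathbb{Z}$-span of all differences of rows $P_g-P_{g'}$, $g,g'\in G$. The invariant factors of a lattice $M\subseteq\mathbb{Z}^N$ of rank $r$ are the nonzero Smith normal form entries $d_1\mid\cdots\mid d_r$ of any integer matrix whose rows generate $M$; the nontrivial ones are those greater than $1$, and the Smith spectrum is the list of nontrivial invariant factors. The cokernel is $\mathbb{Z}^N/M$. A diagonal presentation of a lattice $M\subseteq\mathbb{Z}^N$ of rank $r$ with (positive integer) entries $a_1,\dots,a_r$ means that a generating matrix of $M$ can be brought by unimodular integer row and column operations to a diagonal matrix with nonzero diagonal entries $a_1,\dots,a_r$ (no divisibility chain required); equivalently there is a $\mathbb{Z}$-basis $f_1,\dots,f_N$ of $\mathbb{Z}^N$ such that $a_1f_1,\dots,a_rf_r$ is a basis of $M$. Nontrivial entries are those greater than $1$. The commuting conductor is the set of primes $C_{\mathrm{comm}}(G)=\{p \text{ prime}:\operatorname{rank}_{\mathbb{F}_p}(M_{\mathrm{comm}}(G)\bmod p)<\operatorname{rank}_{\mathbb{Q}}M_{\mathrm{comm}}(G)\}$. *)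

(* Defs.v *)
From HB Require Import structures.
From mathcomp Require Import all_boot all_order all_algebra all_fingroup.

Set Implicit Arguments.
Unset Strict Implicit.
Unset Printing Implicit Defensive.

Import GRing.Theory Num.Theory.
Local Open Scope ring_scope.

(* A lattice in Z^n is a subgroup of 'rV[int]_n.  Subgroups are boolean
   predicates (so that cokernels can be formed with {ideal_quot _}), hence the
   decision procedure for membership in the Z-span of the rows of a matrix. *)
Lemma row_span_dec m n (A : 'M[int]_(m, n)) (v : 'rV[int]_n) :
  decidable (exists u : 'rV[int]_m, v = u *m A).
Proof.
pose s := [tuple map_mx (intr : int -> rat) (row i A) | i < m].
have spanE (u : 'rV[int]_m) :
    map_mx (intr : int -> rat) (u *m A) = \sum_(i < m) s`_i *~ u 0 i.
  rewrite mulmx_sum_row raddf_sum; apply: eq_bigr => i _.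
  rewrite (nth_map i) ?size_enum_ord // nth_ord_enum.
  apply/rowP => j; rewrite mxE -scaler_int !mxE; exact: intrM.
case: (dec_Qint_span s (map_mx intr v)) => [sv | nsv]; [left | right].
  have [a def_v] := sv; exists (\row_i a i).
  have eq_v : map_mx (intr : int -> rat) v =
      map_mx intr ((\row_i a i) *m A).
    by rewrite spanE def_v; apply: eq_bigr => i _; rewrite mxE.
  by apply/rowP => j; have /rowP/(_ j) := eq_v;
    rewrite ![map_mx _ _ _ _]mxE => /intr_inj.
by case=> u def_v; apply: nsv; exists [ffun i => u 0 i]; rewrite def_v spanE;
  apply: eq_bigr => i _; rewrite ffunE.
Qed.

Definition row_lattice m n (A : 'M[int]_(m, n)) : {pred 'rV[int]_n} :=
  fun v => row_span_dec A v.

Lemma row_latticeP m n (A : 'M[int]_(m, n)) (v : 'rV[int]_n) :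
  reflect (exists u : 'rV[int]_m, v = u *m A) (v \in row_lattice A).
Proof. exact: sumboolP. Qed.

Fact row_lattice_zmod_closed m n (A : 'M[int]_(m, n)) :
  zmod_closed (row_lattice A).
Proof.
split=> [|_ _ /row_latticeP[u ->] /row_latticeP[v ->]]; apply/row_latticeP.
  by exists 0; rewrite mul0mx.
by exists (u - v); rewrite mulmxBl.
Qed.

HB.instance Definition _ m n (A : 'M[int]_(m, n)) :=
  GRing.isZmodClosed.Build 'rV[int]_n (row_lattice A)
    (row_lattice_zmod_closed A).

Definition rank_over (F : fieldType) m n (A : 'M[int]_(m, n)) : nat :=
  \rank (map_mx (intr : int -> F) A).

(* The rectangular matrix with the entries of s on its diagonal, padded by 0. *)
Definition diag_seq_mx m n (s : seq nat) : 'M[int]_(m, n) :=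
  \matrix_(i, j) ((nth 0%N s i)%:Z *+ (i == j :> nat)).

Definition diagonal_presentation n (M : zmodClosed 'rV[int]_n) (s : seq nat) :
    Prop :=
  exists m (A : 'M[int]_(m, n)),
    [/\ M =i row_lattice A,
        size s = rank_over rat A,
        (size s <= minn m n)%N,
        all (fun a => 0 < a)%N s &
        exists L : 'M[int]_m, exists R : 'M[int]_n,
          [/\ L \in unitmx, R \in unitmx & L *m A *m R = diag_seq_mx m n s]].

Definition nontrivial (s : seq nat) : seq nat := [seq a <- s | (1 < a)%N].

(* The full list of invariant factors, including those equal to 1. *)
Definition invariant_factors n (M : zmodClosed 'rV[int]_n) (s : seq nat) :
    Prop :=
  diagonal_presentation M s /\ sorted dvdn s.

Definition smith_spectrum n (M : zmodClosed 'rV[int]_n) (t : seq nat) : Prop :=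
  exists2 s, invariant_factors M s & t = nontrivial s.

(* The torsion subgroup of Z^n / M is isomorphic to the direct sum of the
   Z/a for a in t.  Meant for lists t with entries > 1, as 'Z_0 and 'Z_1 are
   both Z/2. *)
Definition coker_torsion_iso n (M : zmodClosed 'rV[int]_n) (t : seq nat) :
    Prop :=
  exists f : {dffun forall i : 'I_(size t), 'Z_(nth 0%N t i)} -> {ideal_quot M},
    [/\ forall u v : {dffun forall i : 'I_(size t), 'Z_(nth 0%N t i)},
          f [ffun i => u i + v i] = f u + f v,
        injective f &
        forall x, (exists u, f u = x) <-> (exists2 k, (0 < k)%N & x *+ k = 0)].

(* Canonical regrouping of a list of positive integers into invariant factors:
   for each prime p, the exponents of p in the entries of s are sorted in
   increasing order, and the k-th factor collects the k-th exponent of every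
   prime; the factors equal to 1 are then dropped. *)
Definition regroup (s : seq nat) : seq nat :=
  nontrivial (mkseq (fun k =>
    \prod_(p <- primes (\prod_(b <- s) b))
       p ^ nth 0 (sort leq [seq logn p b | b <- s]) k)%N (size s)).

Definition commuting_mx (gT : finGroupType) : 'M[int]_#|gT| :=
  \matrix_(i, j)
    (enum_val i * enum_val j == enum_val j * enum_val i)%g%:R.

(* One row P_g - P_g' for each pair (g, g'). *)
Definition comm_diff_mx (gT : finGroupType) :
    'M[int]_(#|{: gT * gT}|, #|gT|) :=
  \matrix_k (row (enum_rank (enum_val k).1) (commuting_mx gT) -
            row (enum_rank (enum_val k).2) (commuting_mx gT)).

Definition comm_lattice (gT : finGroupType) : zmodClosed 'rV[int]_#|gT| :=
  row_lattice (comm_diff_mx gT).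

(* The rows of comm_diff_mx mod p generate the reduction mod p of the lattice,
   so both ranks can be read off from this matrix. *)
Definition comm_conductor (gT : finGroupType) : pred nat :=
  [pred p | prime p &&
    (rank_over 'F_p (comm_diff_mx gT) < rank_over rat (comm_diff_mx gT))%N].

(* Main.v *)
Require Import Defs.
From mathcomp Require Import all_boot all_order all_algebra all_fingroup.
From mathcomp Require Import zify.
From mathcomp.real_closed Require Import mxtens.

Set Implicit Arguments.
Unset Strict Implicit.
Unset Printing Implicit Defensive.

Import GRing.Theory Num.Theory.
Local Open Scope ring_scope.

(** Let [P] be the commuting matrix of a group and [h] the column of the identity.
    That column consists of ones, so the difference lattice of [P] is the part of
    the full row lattice [L(P)] lying in the hyperplane where coordinate [h]
    vanishes ([mem_comm_lattice]).  The row lattice splits as the line spanned by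
    row [h] plus that part.  Applying the Smith normal form to the part alone
    yields a basis of the ambient space in which [L(P)] is diagonal with entries
    [1, d_1, d_2, ..], in such a way that reading off coordinate [h] of a vector
    is the same as reading off its coefficient at the basis vector of weight 1
    ([pointed_weights], [pointed_weights_exist]).

    Elements of [G x H] commute iff both components do, so the commuting matrix of
    [G x H] is the Kronecker product of those of [G] and [H], up to the order of
    the index set ([commuting_mx_prod]).  Kronecker products of bases are bases,
    and they multiply weights ([pointed_tens]); hence [L(P_(G x H))] is diagonal
    with entries the products of an element of [1, d_1, ..] by one of
    [1, e_1, ..].  Intersecting again with the hyperplane removes exactly the
    entry [1 * 1] ([pointed_hyperplane]) and leaves the [d_i], the [e_j] and the
    [d_i e_j] ([comm_lattice_prod]).

    The other conclusions hold for any diagonal presentation [s] of any lattice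
    [M].  Modulo [N], the number of solutions of the linear system whose
    equations are the vectors of [M] is the product of the [gcd(s_i, N)], padding
    [s] by zeros ([card_annihilator]).  Taking [N] to be the powers of a prime [p]
    shows that the multiset of the [p]-adic valuations of the entries depends only
    on [M] ([perm_logn_presentation]).  A divisibility chain has its valuations in
    increasing order, so the invariant factors are determined by [M] and can be
    computed from [s] by regrouping prime by prime
    ([nontrivial_invariant_factors]).  In adapted coordinates the torsion of the
    cokernel is the product of the [Z/s_i] ([coker_torsion_presentation]), and the
    rank over a field is the number of entries that are nonzero in it
    ([rank_over_seq]), so [p] is in the conductor iff [p] divides some entry.
    Finally [p] divides some [d_i], [e_j] or [d_i e_j] iff it divides some [d_i]
    or some [e_j]. *)

(** * Generators of a lattice *)

Lemma row_lattice_self m n (A : 'M[int]_(m, n)) i : row i A \in row_lattice A.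
Proof. by apply/row_latticeP; exists (delta_mx 0 i); rewrite rowE. Qed.

(** Inclusion of row lattices is left divisibility of matrices; this turns
    statements on lattices into matrix identities, which are then transported by
    products, Kronecker products and reduction into other rings. *)
Lemma row_lattice_mulP m1 m2 n (A : 'M[int]_(m1, n)) (B : 'M[int]_(m2, n)) :
  {subset row_lattice A <= row_lattice B} <-> exists X, A = X *m B.
Proof.
split=> [sAB | [X ->] _ /row_latticeP[u ->]]; last first.
  by apply/row_latticeP; exists (u *m X); rewrite mulmxA.
have rowB i : exists u, row i A == u *m B.
  by have /row_latticeP[u ->] := sAB _ (row_lattice_self A i); exists u.
exists (\matrix_i xchoose (rowB i)); apply/row_matrixP => i.
by rewrite row_mul rowK; apply/eqP/(xchooseP (rowB i)).
Qed.

Lemma row_lattice_eqP m1 m2 n (A : 'M[int]_(m1, n)) (B : 'M[int]_(m2, n)) :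
  row_lattice A =i row_lattice B <->
  (exists X, A = X *m B) /\ (exists Y, B = Y *m A).
Proof.
split=> [eqAB | [/row_lattice_mulP sAB /row_lattice_mulP sBA] v].
  by split; apply/row_lattice_mulP => v; rewrite eqAB.
by apply/idP/idP=> [/sAB | /sBA].
Qed.

Lemma row_lattice_mulr m1 m2 n p (A : 'M[int]_(m1, n)) (B : 'M[int]_(m2, n))
    (R : 'M[int]_(n, p)) :
  row_lattice A =i row_lattice B ->
  row_lattice (A *m R) =i row_lattice (B *m R).
Proof.
case/row_lattice_eqP=> -[X eqA] [Y eqB]; apply/row_lattice_eqP.
by split; [exists X; rewrite mulmxA -eqA | exists Y; rewrite mulmxA -eqB].
Qed.

Lemma row_lattice_unitl m n (L : 'M[int]_m) (A : 'M[int]_(m, n)) :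
  L \in unitmx -> row_lattice (L *m A) =i row_lattice A.
Proof.
move=> uL; apply/row_lattice_eqP; split; first by exists L.
by exists (invmx L); rewrite mulKmx.
Qed.

(** * Diagonal presentations in a fixed basis *)

Definition weight_mx n (w : 'I_n -> nat) : 'M[int]_n :=
  diag_mx (\row_i (w i)%:Z).

Lemma mul_weight_mx n p (w : 'I_n -> nat) (A : 'M[int]_(n, p)) i j :
  (weight_mx w *m A) i j = (w i)%:Z * A i j.
Proof. by rewrite mul_diag_mx !mxE. Qed.

Lemma row_mul_weight_mx n (w : 'I_n -> nat) (u : 'rV[int]_n) i :
  (u *m weight_mx w) 0 i = u 0 i * (w i)%:Z.
Proof. by rewrite mul_mx_diag !mxE. Qed.

Lemma mem_weight_lattice n (w : 'I_n -> nat) (R : 'M[int]_n) v :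
  R \in unitmx ->
  (v \in row_lattice (weight_mx w *m R)) =
  [forall i, ((v *m invmx R) 0%R i \in dvdz (w i))].
Proof.
move=> uR; apply/row_latticeP/forallP => [[u ->] i | dv].
  by rewrite mulmxA mulmxK // row_mul_weight_mx dvdz_mull.
exists (\row_i divz ((v *m invmx R) 0 i) (w i)); rewrite mulmxA.
rewrite -[LHS](mulmxKV uR); congr (_ *m R); apply/rowP => i.
by rewrite row_mul_weight_mx mxE divzK.
Qed.

(** A diagonal presentation stripped of the choice of generators: the rows of [R]
    are the adapted basis.  The weights are indexed by all of ['I_n], a zero
    weight marking a basis vector with no nonzero multiple in [M], so that no
    particular order of the entries is imposed. *)
Definition has_weights n (M : zmodClosed 'rV[int]_n) (w : 'I_n -> nat) : Prop :=
  exists2 R : 'M[int]_n, R \in unitmx & M =i row_lattice (weight_mx w *m R).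

Lemma has_weights_perm n (M : zmodClosed 'rV[int]_n) (w : 'I_n -> nat)
    (s : 'S_n) :
  has_weights M w -> has_weights M (w \o s).
Proof.
case=> R uR defM; exists (row_perm s R).
  by rewrite row_permE unitmx_mul unitmx_perm.
move=> v; rewrite defM -[in LHS](row_lattice_unitl _ (unitmx_perm _ s)).
rewrite -row_permE; congr (_ \in row_lattice _).
by apply/matrixP => i j; rewrite mxE !mul_weight_mx !mxE.
Qed.

Lemma codom_mktuple n (w : 'I_n -> nat) : codom w = mktuple w.
Proof. by rewrite codomE -val_ord_tuple. Qed.

Lemma nth_codom_ord n (w : 'I_n -> nat) (i : 'I_n) :
  nth 0%N (codom w) i = w i.
Proof. by rewrite codom_mktuple -tnth_nth tnth_mktuple. Qed.

Lemma codom_nth_pad n (s : seq nat) : (size s <= n)%N ->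
  codom (fun i : 'I_n => nth 0 s i)%N = s ++ nseq (n - size s) 0%N.
Proof.
move=> le_sn; apply: (@eq_from_nth _ 0%N) => [|i].
  by rewrite size_codom card_ord size_cat size_nseq subnKC.
rewrite size_codom card_ord => lt_in; rewrite (nth_codom_ord _ (Ordinal lt_in)).
rewrite nth_cat nth_nseq; case: ltnP => // le_si.
by rewrite nth_default // if_same.
Qed.

Lemma has_weights_perm_eq n (M : zmodClosed 'rV[int]_n) (w w' : 'I_n -> nat) :
  perm_eq (codom w) (codom w') -> has_weights M w -> has_weights M w'.
Proof.
move=> eqw; have : perm_eq (mktuple w') (mktuple w).
  by rewrite -!codom_mktuple perm_sym.
case/tuple_permP => s eqw' wM.
have [R uR defM] := has_weights_perm s wM; exists R => // v; rewrite defM.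
congr (_ \in row_lattice (diag_mx _ *m _)); apply/rowP => i; rewrite !mxE /=.
have /val_inj/(congr1 (fun t => tnth t i)) := eqw'.
by rewrite !tnth_mktuple => ->.
Qed.

Lemma diag_seq_sqmx n (s : seq nat) :
  diag_seq_mx n n s = weight_mx (fun i => nth 0 s i)%N.
Proof. by apply/matrixP => i j; rewrite !mxE. Qed.

(** Once all entries of [s] fit on the diagonal, the remaining rows are zero, so
    a square diagonal matrix has the same row lattice. *)
Lemma row_lattice_diag_seq m n (s : seq nat) :
  (size s <= minn m n)%N ->
  row_lattice (diag_seq_mx m n s) =i row_lattice (diag_seq_mx n n s).
Proof.
rewrite leq_min => /andP[le_sm le_sn]; apply/row_lattice_eqP.
have castE p q r : (size s <= q)%N -> diag_seq_mx p r s =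
    (\matrix_(i < p, j < q) (i == j :> nat)%:R) *m diag_seq_mx q r s.
  move=> le_sq; apply/matrixP => i j; rewrite !mxE.
  have [lt_iq | le_qi] := ltnP i q.
    rewrite (bigD1 (Ordinal lt_iq)) //= !mxE eqxx mul1r big1 ?addr0 // => k.
    by rewrite -val_eqE !mxE /= eq_sym => /negPf->; rewrite mul0r.
  rewrite nth_default ?mul0rn ?(leq_trans le_sq) // big1 // => k _.
  by rewrite !mxE gtn_eqF ?mul0r // (leq_trans (ltn_ord k)).
by split; eexists; apply: castE.
Qed.

(** * Ranks and diagonal presentations *)

Lemma rank_over_row_lattice (F : fieldType) m1 m2 n
    (A : 'M[int]_(m1, n)) (B : 'M[int]_(m2, n)) :
  row_lattice A =i row_lattice B -> rank_over F A = rank_over F B.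
Proof.
case/row_lattice_eqP=> -[X defA] [Y defB]; apply/eqP; rewrite eqn_leq.
apply/andP; split; rewrite /rank_over; apply/mxrankS.
  by rewrite defA map_mxM submxMl.
by rewrite defB map_mxM submxMl.
Qed.

Lemma mxrank_diag (F : fieldType) n (d : 'rV[F]_n) :
  \rank (diag_mx d) = (\sum_i (d 0%R i != 0%R))%N.
Proof.
elim: n d => [|n IHn] d; first by rewrite big_ord0 [diag_mx _]flatmx0 mxrank0.
pose dl := @lsubmx _ 1 1 n d; pose dr := @rsubmx _ 1 1 n d.
have -> : \rank (diag_mx d) = (\rank (diag_mx dl) + \rank (diag_mx dr))%N.
  by rewrite -rank_diag_block_mx -diag_mx_row hsubmxK.
rewrite IHn (@big_split_ord _ _ _ 1 n) big_ord1.
congr (_ + _)%N; last by apply: eq_bigr => i _; rewrite mxE.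
rewrite rank_rV; congr (nat_of_bool (~~ _)).
apply/eqP/eqP => [/matrixP/(_ 0 0) | d0]; first by rewrite !mxE eqxx.
by apply/matrixP => i j; rewrite !mxE !ord1 [d _ _]d0 mul0rn.
Qed.

(** A unimodular matrix stays invertible over any field, so the rank is that of
    the diagonal matrix of the weights. *)
Lemma rank_over_weights (F : fieldType) m n (A : 'M[int]_(m, n)) w :
  has_weights (row_lattice A) w ->
  rank_over F A = (\sum_i ((w i)%:R != 0%R :> F))%N.
Proof.
case=> R uR /(@rank_over_row_lattice F)->; rewrite /rank_over map_mxM mxrankMfree.
  by rewrite map_diag_mx mxrank_diag; apply: eq_bigr => i _; rewrite !mxE.
by rewrite row_free_unit unitmxE det_map_mx rmorph_unit.
Qed.

Lemma sum_nth_pad (T : nat -> nat) n (s : seq nat) :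
  T 0%N = 0%N -> (size s <= n)%N ->
  (\sum_(i < n) T (nth 0 s i) = \sum_(a <- s) T a)%N.
Proof.
move=> T0 le_sn; rewrite (big_nth 0%N) big_mkord.
rewrite [RHS](big_ord_widen n (fun i => T (nth 0 s i)%N)) // [RHS]big_mkcond /=.
apply: eq_bigr => i _; case: ltnP => // le_si.
by rewrite nth_default.
Qed.

Lemma rank_over_seq (F : fieldType) m n (A : 'M[int]_(m, n)) (s : seq nat) :
  (size s <= n)%N ->
  has_weights (row_lattice A) (fun i => nth 0 s i)%N ->
  rank_over F A = count (fun a => a%:R != 0 :> F) s.
Proof.
move=> le_sn /(@rank_over_weights F)->.
rewrite (@sum_nth_pad (fun a => a%:R != 0 :> F)) ?eqxx // -sum1_count.
by rewrite [RHS]big_mkcond; apply: eq_bigr => a _; case: (_ != 0).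
Qed.

(** The choice of generators is immaterial: any generating matrix has the same row
    lattice, up to a unimodular left factor, as the diagonal matrix times the
    inverse of the right factor.  The rank is the number of entries because these
    are positive. *)
Lemma diagonal_presentationP n (M : zmodClosed 'rV[int]_n) (s : seq nat) :
  diagonal_presentation M s <->
  [/\ (size s <= n)%N, all (fun a => 0 < a)%N s &
      has_weights M (fun i => nth 0 s i)%N].
Proof.
split=> [[m [A [defM szs le_s s_gt0 [L [R [uL uR defA]]]]]] | [le_sn s_gt0 wM]].
  split=> //; first by move: le_s; rewrite leq_min => /andP[].
  exists (invmx R); first by rewrite unitmx_inv.
  move=> v; rewrite defM -(row_lattice_unitl _ uL) -diag_seq_sqmx.
  rewrite -(row_lattice_mulr _ (row_lattice_diag_seq le_s)) -defA.
  by rewrite mulmxK.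
have [R uR defM] := wM.
exists n, (weight_mx (fun i => nth 0 s i)%N *m R); split=> //; last 1 first.
- exists 1%:M, (invmx R); rewrite unitmx1 unitmx_inv uR mul1mx mulmxK //.
  by rewrite diag_seq_sqmx.
- rewrite (rank_over_seq _ le_sn); last by exists R.
  rewrite -[LHS](count_predT s); apply/eq_in_count => a /(allP s_gt0).
  by rewrite pnatr_eq0 lt0n => ->.
by rewrite minnn.
Qed.

(** Reordering the basis brings the zero weights to the end, so the positive ones
    can be listed in any order. *)
Lemma has_weights_presentation n (M : zmodClosed 'rV[int]_n) (w : 'I_n -> nat)
    (s : seq nat) :
  has_weights M w -> perm_eq s [seq a <- codom w | (0 < a)%N] ->
  diagonal_presentation M s.
Proof.
move=> wM eqs; have le_sn : (size s <= n)%N.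
  rewrite (perm_size eqs) size_filter (leq_trans (count_size _ _)) //.
  by rewrite size_codom card_ord.
apply/diagonal_presentationP; split=> //.
  by rewrite (perm_all _ eqs) filter_all.
apply: has_weights_perm_eq wM.
rewrite codom_nth_pad //.
rewrite -(perm_filterC (fun a => 0 < a)%N (codom w)).
have -> : (n - size s = count (fun a => a == 0) (codom w))%N.
  rewrite (perm_size eqs) size_filter.
  rewrite [RHS](@eq_count _ _ (predC (leq 1))) => [|[]//].
  apply/eqP; rewrite -(eqn_add2l (count (leq 1) (codom w))) count_predC subnKC.
    by rewrite size_codom card_ord.
  by rewrite (leq_trans (count_size _ _)) // size_codom card_ord.
apply: perm_cat; first by rewrite perm_sym.
have -> : [seq a <- codom w | predC (leq 1) a] = [seq a <- codom w | a == 0%N].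
  by apply: eq_filter => -[].
by rewrite -size_filter -(elimT (all_pred1P _ _) (filter_all (pred1 0%N) _)).
Qed.

Lemma perm_diagonal_presentation n (M : zmodClosed 'rV[int]_n) s t :
  perm_eq s t -> diagonal_presentation M s -> diagonal_presentation M t.
Proof.
move=> eq_st /diagonal_presentationP[le_sn s_gt0 sM].
apply: (has_weights_presentation sM); rewrite codom_nth_pad // filter_cat.
by rewrite filter_nseq cats0 (all_filterP s_gt0) perm_sym.
Qed.

(** * Smith normal form and its uniqueness *)

(** The Smith normal form over the integers leaves signs and a possible tail of
    zeros, or of entries beyond the last row; the former are absorbed by units
    and the latter become zero weights.  Zero is the largest element for
    divisibility, so the weights still form a chain. *)
Lemma invariant_factors_exist m n (A : 'M[int]_(m, n)) :
  exists s, invariant_factors (row_lattice A) s.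
Proof.
have [L uL [R uR [d d_sorted ->]]] := int_Smith_normal_form A.
pose w (i : 'I_n) := if (i < m)%N then absz d`_i else 0%N.
exists [seq a <- codom w | (0 < a)%N]; split.
  apply: (@has_weights_presentation _ _ w); last exact: perm_refl.
  exists R => // v; rewrite -mulmxA (row_lattice_unitl _ uL).
  apply: row_lattice_mulr; apply/row_lattice_eqP; split.
    exists (\matrix_(i, j) (sgz d`_i *+ (i == j :> nat))).
    apply/matrixP => i j; rewrite mul_mx_diag !mxE /w.
    case: eqP => [<- | _]; last by rewrite !mulr0n mul0r.
    by rewrite ltn_ord !mulr1n -intEsg.
  exists (\matrix_(i, j) (sgz d`_i *+ (i == j :> nat))).
  apply/matrixP => i j; rewrite !mxE /w; case: ltnP => [lt_im | le_mi].
    rewrite (bigD1 (Ordinal lt_im)) //= !mxE eqxx /= big1 ?addr0 => [|k].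
      rewrite mulr1n mulrnAr; congr (_ *+ _).
      by rewrite -abszEsg.
    by rewrite -val_eqE !mxE /= eq_sym => /negPf->; rewrite mul0r.
  rewrite mul0rn big1 // => k _.
  by rewrite !mxE gtn_eqF ?mulr0n ?mul0r // (leq_trans (ltn_ord k)).
apply: sorted_filter; first exact: dvdn_trans.
apply/(sortedP 0%N) => i; rewrite size_codom card_ord => lt_in.
rewrite (nth_codom_ord w (Ordinal lt_in)).
rewrite (nth_codom_ord w (Ordinal (ltnW lt_in))) /w /=.
case: (ltnP i.+1 m) => // lt_im; rewrite (ltnW lt_im).
have [lt_id | le_di] := ltnP i.+1 (size d); last by rewrite [d`_i.+1]nth_default.
by have /(sortedP 0)/(_ i lt_id) := d_sorted.
Qed.

(** Going from [k] to [k + 1] increases the truncated sum by the number of entries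
    that are at most [k], so these sums determine all multiplicities. *)
Lemma perm_eq_truncated_sums (s t : seq nat) :
  (forall k, \sum_(a <- s) (k - a) = \sum_(a <- t) (k - a))%N -> perm_eq s t.
Proof.
move=> eq_sums.
have stepE r k : (\sum_(a <- r) (k.+1 - a) =
                  \sum_(a <- r) (k - a) + count (geq k) r)%N.
  rewrite -sum1_count [X in (_ + X)%N]big_mkcond -big_split /=.
  by apply: eq_bigr => a _; rewrite /geq /=; case: leqP; lia.
have eq_le k : count (geq k) s = count (geq k) t.
  apply: (@addnI (\sum_(a <- s) (k - a))%N).
  by rewrite -stepE (eq_sums k) (eq_sums k.+1) stepE.
have memE r k : (count_mem k.+1 r = count (geq k.+1) r - count (geq k) r)%N.
  apply/eqP; rewrite -(eqn_add2l (count (geq k) r)) subnKC; last first.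
    by apply: sub_count => a /leqW.
  rewrite -count_predUI [X in (_ + X)%N](@eq_count _ _ pred0) => [|a]; last first.
    by rewrite /= andbC; case: eqP => // ->; rewrite /geq /= ltnn.
  rewrite count_pred0 addn0; apply/eqP/eq_count => a /=.
  by rewrite /geq /= orbC -leq_eqVlt.
apply/allP => -[|k] _; last by rewrite /= !memE !eq_le.
have mem0E r : count_mem 0%N r = count (geq 0%N) r by apply: eq_count => -[].
by rewrite /= !mem0E eq_le.
Qed.

(** With [g = gcd(a, n)], the condition on [x] says that [n / g] divides [x], which
    happens [g] times in a period of length [n]. *)
Lemma sum_dvdn_mul n a :
  (0 < n)%N -> (\sum_(x < n) (n %| a * x) = gcdn a n)%N.
Proof.
move=> n_gt0; set g := gcdn a n.
have g_gt0 : (0 < g)%N by rewrite gcdn_gt0 n_gt0 orbT.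
have g_dvd : (g %| n)%N by rewrite dvdn_gcdr.
have a_dvd : (g %| a)%N by rewrite dvdn_gcdl.
have dvdE (x : nat) : (n %| a * x)%N = (n %/ g %| x)%N.
  rewrite -(divnK a_dvd) -{1}(divnK g_dvd) mulnAC dvdn_pmul2r //.
  rewrite Gauss_dvdr // /coprime -(eqn_pmul2r g_gt0) muln_gcdl mul1n.
  by rewrite !divnK // gcdnC.
under eq_bigr => x _ do rewrite dvdE.
clearbody g.
transitivity (n %/ (n %/ g))%N; last first.
  by rewrite -{1}(divnK g_dvd) mulKn // divn_gt0 // dvdn_leq.
rewrite [RHS]divn_count_dvd.
transitivity (\sum_(0 <= x < n) (n %/ g %| x))%N; first by rewrite big_mkord.
rewrite [RHS]big_nat_recr //= [LHS]big_ltn // dvdn0 addnC.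
by rewrite -[X in (_ %| X)%N](divnK g_dvd) dvdn_mulr.
Qed.

Lemma natr_mul_eq0_Zp n a (x : 'I_n.+2) : (a%:R * x == 0) = (n.+2 %| a * x)%N.
Proof.
rewrite -[x in LHS]natr_Zp -natrM Zp_nat -val_eqE /=.
by [].
Qed.

Lemma card_mul_eq0_Zp N a :
  (1 < N)%N -> #|[pred x : 'Z_N | a%:R * x == 0]| = gcdn a N.
Proof.
case: N => [|[|N]] // _; rewrite -sum_dvdn_mul // -sum1_card big_mkcond /=.
by apply: eq_bigr => x _; rewrite -natr_mul_eq0_Zp.
Qed.

(** The solution set of a linear system modulo [N] is invariant under row
    operations, and its size under invertible changes of variables: this makes it
    a tool to compare two diagonal presentations of one lattice. *)
Definition annihilator N m n (A : 'M[int]_(m, n)) : {set 'cV['Z_N]_n} :=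
  [set x | map_mx intr A *m x == 0].

Lemma eq_annihilator N m1 m2 n (A : 'M[int]_(m1, n)) (B : 'M[int]_(m2, n)) :
  row_lattice A =i row_lattice B -> annihilator N A = annihilator N B.
Proof.
case/row_lattice_eqP=> -[X defA] [Y defB]; apply/setP => x; rewrite !inE.
apply/eqP/eqP => [A0 | B0].
  by rewrite defB map_mxM -mulmxA A0 mulmx0.
by rewrite defA map_mxM -mulmxA B0 mulmx0.
Qed.

Lemma card_annihilator_weights N n (w : 'I_n -> nat) :
  (1 < N)%N -> #|annihilator N (weight_mx w)| = (\prod_i gcdn (w i) N)%N.
Proof.
move=> N_gt1.
pose F i := [pred x : 'Z_N | (w i)%:R * x == 0].
pose col (f : {ffun 'I_n -> 'Z_N}) : 'cV['Z_N]_n := \col_i f i.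
have inj_col : injective col.
  by move=> f g /colP eqfg; apply/ffunP => i; have := eqfg i; rewrite !mxE.
have -> : annihilator N (weight_mx w) = col @: [set f in family F].
  apply/setP => x; rewrite inE map_diag_mx; apply/eqP/imsetP => [x0 | [f]].
    exists [ffun i => x i 0]; last by apply/colP => i; rewrite !mxE ffunE.
    rewrite inE; apply/familyP => i; rewrite ffunE inE.
    by have /colP/(_ i) := x0; rewrite mul_diag_mx !mxE => /eqP.
  rewrite inE => /familyP Ff ->; apply/colP => i; rewrite mul_diag_mx !mxE.
  by have := Ff i; rewrite inE => /eqP.
rewrite card_imset // cardsE card_family foldrE big_map big_enum /=.
by apply: eq_bigr => i _; apply: card_mul_eq0_Zp.
Qed.

Lemma card_annihilator N n (M : zmodClosed 'rV[int]_n) w m (A : 'M_(m, n)) :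
  (1 < N)%N -> M =i row_lattice A -> has_weights M w ->
  #|annihilator N A| = (\prod_i gcdn (w i) N)%N.
Proof.
move=> N_gt1 eqM [R uR defM]; rewrite -card_annihilator_weights //.
have uRN : map_mx intr R \in @unitmx 'Z_N n.
  by rewrite unitmxE det_map_mx rmorph_unit.
rewrite -(card_preimset (annihilator N (weight_mx w)) (can_inj (mulKmx uRN))).
have -> : annihilator N A = annihilator N (weight_mx w *m R).
  by apply: eq_annihilator => v; rewrite -eqM.
by congr #|pred_of_set _|; apply/setP => x; rewrite !inE map_mxM mulmxA.
Qed.

Lemma logn_prod (I : eqType) (r : seq I) (F : I -> nat) p :
  {in r, forall i, 0 < F i}%N ->
  logn p (\prod_(i <- r) F i) = (\sum_(i <- r) logn p (F i))%N.
Proof.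
elim: r => [|i r IHr] F_gt0; first by rewrite !big_nil logn1.
have Fr_gt0 : {in r, forall j, 0 < F j}%N.
  by move=> j rj; rewrite F_gt0 // inE rj orbT.
rewrite !big_cons lognM ?IHr ?F_gt0 ?mem_head //.
by rewrite big_seq prodn_cond_gt0.
Qed.

(** For [N = p ^ k], the logarithm of the number of solutions is the sum of the
    [min(v_i, k)], where [v_i] is the valuation of the [i]-th weight, infinite for
    a zero weight.  Subtracting from [n * k] leaves the sum of the truncated
    differences [k - v_i], in which zero weights do not count. *)
Lemma perm_logn_presentation n (M : zmodClosed 'rV[int]_n) (s t : seq nat) p :
  prime p -> diagonal_presentation M s -> diagonal_presentation M t ->
  perm_eq [seq logn p a | a <- s] [seq logn p a | a <- t].
Proof.
move=> p_pr sM tM; apply: perm_eq_truncated_sums => k; rewrite !big_map.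
case: k => [|k']; first by rewrite !big1.
set k := k'.+1.
have pk_gt0 : (0 < p ^ k)%N by rewrite expn_gt0 prime_gt0.
have pk_gt1 : (1 < p ^ k)%N by rewrite -(exp1n k) ltn_exp2r ?prime_gt1.
have [m [A [eqA _ _ _ _]]] := sM.
pose e a := logn p (gcdn a (p ^ k)).
have e0 : e 0%N = k by rewrite /e gcd0n pfactorK.
have eE a : (0 < a)%N -> e a = minn (logn p a) k.
  by move=> a_gt0; rewrite /e logn_gcd // pfactorK.
have le_ek a : (e a <= k)%N by case: a => [|a]; rewrite ?e0 // eE // geq_minr.
(* A zero entry contributes the full exponent k, hence nothing to k - e. *)
have truncE r : diagonal_presentation M r ->
    (\sum_(a <- r) (k - logn p a) = n * k - logn p #|annihilator (p ^ k) A|)%N.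
  case/diagonal_presentationP=> le_rn r_gt0 rM.
  rewrite (card_annihilator pk_gt1 eqA rM) logn_prod; last first.
    by move=> i _; rewrite gcdn_gt0 pk_gt0 orbT.
  rewrite -[n in (n * k)%N]card_ord -sum_nat_const -sumnB; last by move=> *; apply: le_ek.
  rewrite (@sum_nth_pad (fun a => k - e a)%N) // ?e0 ?subnn //.
  apply: eq_big_seq => a /(allP r_gt0) a_gt0.
  by rewrite eE // minnE; lia.
by rewrite !truncE.
Qed.

Lemma sorted_logn p s :
  all (fun a => 0 < a)%N s -> sorted dvdn s -> sorted leq [seq logn p a | a <- s].
Proof.
move=> s_gt0 s_sorted; rewrite sorted_map.
apply: sub_in_sorted s_gt0 s_sorted => a b a_gt0 b_gt0.
exact: dvdn_leq_log.
Qed.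

(** Valuations increase along a divisibility chain, so they are the sorted version
    of the multiset that every presentation shares. *)
Lemma logn_invariant_factors n (M : zmodClosed 'rV[int]_n) (s t : seq nat) p :
  prime p -> diagonal_presentation M s -> invariant_factors M t ->
  [seq logn p a | a <- t] = sort leq [seq logn p a | a <- s].
Proof.
move=> p_pr sM [tM t_sorted]; have [_ t_gt0 _] := (diagonal_presentationP _ _).1 tM.
apply: (sorted_eq leq_trans anti_leq); first exact: sorted_logn.
  exact: sort_sorted leq_total _.
by rewrite perm_sym perm_sort (perm_logn_presentation p_pr sM tM).
Qed.

Lemma size_invariant_factors n (M : zmodClosed 'rV[int]_n) (s t : seq nat) :
  diagonal_presentation M s -> diagonal_presentation M t -> size s = size t.
Proof.
move=> sM tM; rewrite -(size_map (logn 2) s) -(size_map (logn 2) t).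
exact/perm_size/(perm_logn_presentation (isT : prime 2) sM tM).
Qed.

(** A positive integer is determined by its valuations. *)
Lemma invariant_factors_uniq n (M : zmodClosed 'rV[int]_n) s t :
  invariant_factors M s -> invariant_factors M t -> s = t.
Proof.
move=> sM tM; have [_ s_gt0 _] := (diagonal_presentationP _ _).1 sM.1.
have [_ t_gt0 _] := (diagonal_presentationP _ _).1 tM.1.
have eq_sz := size_invariant_factors sM.1 tM.1.
apply: (@eq_from_nth _ 0%N) => // i lt_is.
apply: eqn_from_log => [||p].
- by apply: (allP s_gt0); rewrite mem_nth.
- by apply: (allP t_gt0); rewrite mem_nth -?eq_sz.
case p_pr : (prime p); last by rewrite [LHS]lognE [RHS]lognE p_pr.
have eq_log : [seq logn p a | a <- s] = [seq logn p a | a <- t].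
  by rewrite [RHS](logn_invariant_factors p_pr sM.1 tM);
    exact: logn_invariant_factors p_pr sM.1 sM.
by have := congr1 (nth 0%N ^~ i) eq_log; rewrite !(nth_map 0%N) -?eq_sz.
Qed.

(** * Regrouping by primes *)

Lemma perm_nontrivial s :
  all (fun a => 0 < a)%N s ->
  perm_eq s (nseq (count (pred1 1%N) s) 1%N ++ nontrivial s).
Proof.
move=> s_gt0; rewrite -(perm_filterC (pred1 1%N)); apply: perm_cat.
  by rewrite -size_filter -(elimT (all_pred1P _ _) (filter_all (pred1 1%N) _)).
rewrite (_ : nontrivial s = [seq a <- s | predC (pred1 1%N) a]) //.
by apply: eq_in_filter => -[|[|a]] // /(allP s_gt0).
Qed.

(** The list [ms] omits the entries equal to 1 of [s], while [t] has as many
    entries as [s].  If [c] entries are omitted, then all valuations of the first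
    [c] entries of [t] vanish, so [t] starts with [c] ones.  After these, the
    valuations of the [k]-th entry are, for each prime, the [k]-th ones in the
    sorted list of the valuations of [ms]. *)
Lemma nontrivial_invariant_factors n (M : zmodClosed 'rV[int]_n) s t ms :
  diagonal_presentation M s -> invariant_factors M t ->
  perm_eq ms (nontrivial s) -> nontrivial t = regroup ms.
Proof.
move=> sM tM eq_ms.
have [_ s_gt0 _] := (diagonal_presentationP _ _).1 sM.
have [_ t_gt0 _] := (diagonal_presentationP _ _).1 tM.1.
set c := count (pred1 1%N) s.
have eq_s : perm_eq s (nseq c 1%N ++ ms).
  by rewrite (permPl (perm_nontrivial s_gt0)) perm_cat2l perm_sym.
have ms_gt0 : all (fun a => 0 < a)%N ms.
  by move: s_gt0; rewrite (perm_all _ eq_s) all_cat => /andP[].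
have szt : size t = (c + size ms)%N.
  by rewrite -(size_invariant_factors sM tM.1) (perm_size eq_s) size_cat size_nseq.
have lognt p : prime p ->
    [seq logn p a | a <- t] = nseq c 0%N ++ sort leq [seq logn p b | b <- ms].
  move=> p_pr; rewrite (logn_invariant_factors p_pr sM tM).
  apply: (sorted_eq leq_trans anti_leq); first exact: sort_sorted leq_total _.
    elim: (c) => [|b IHb] /=; first exact: sort_sorted leq_total _.
    by rewrite path_min_sorted //; apply/allP.
  rewrite perm_sort (permPl (perm_map _ eq_s)) map_cat map_nseq logn1.
  by rewrite perm_cat2l perm_sym perm_sort.
have lognt_nth p i : prime p -> (i < size t)%N -> logn p (nth 0%N t i) =
    if (i < c)%N then 0%N else nth 0%N (sort leq [seq logn p b | b <- ms]) (i - c).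
  move=> p_pr lt_it; rewrite -(nth_map 0%N 0%N (logn p)) // lognt //.
  by rewrite nth_cat size_nseq nth_nseq if_same.
have gt0t i : (i < size t)%N -> (0 < nth 0%N t i)%N.
  by move=> lt_it; apply: (allP t_gt0); apply: mem_nth.
have -> : t = nseq c 1%N ++ drop c t.
  rewrite -[LHS](cat_take_drop c); congr (_ ++ _).
  apply: (@eq_from_nth _ 0%N) => [|i].
    by rewrite size_takel ?size_nseq // szt leq_addr.
  rewrite size_takel ?szt ?leq_addr // => lt_ic; rewrite nth_take // nth_nseq lt_ic.
  have lt_it : (i < size t)%N by rewrite szt ltn_addr.
  apply: eqn_from_log; rewrite ?gt0t // => p; rewrite logn1.
  case p_pr : (prime p); last by rewrite lognE p_pr.
  by rewrite lognt_nth // lt_ic.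
rewrite /nontrivial filter_cat filter_nseq /= /regroup; congr filter.
have szd : size (drop c t) = size ms by rewrite size_drop szt addKn.
apply: (@eq_from_nth _ 0%N) => [|i]; rewrite ?size_mkseq // szd => lt_i.
have lt_it : (c + i < size t)%N by rewrite szt ltn_add2l.
rewrite nth_mkseq // nth_drop.
have ms_prod : {in ms, forall b, 0 < b}%N by move=> b /(allP ms_gt0).
have pow_gt0 : {in primes (\prod_(b <- ms) b), forall p,
    0 < p ^ nth 0 (sort leq [seq logn p b | b <- ms]) i}%N.
  by move=> p; rewrite mem_primes => /andP[/prime_gt0 p_gt0 _]; rewrite expn_gt0 p_gt0.
apply: eqn_from_log => [||q].
- exact: gt0t.
- by rewrite big_seq prodn_cond_gt0.
case q_pr : (prime q); last by rewrite [LHS]lognE [RHS]lognE q_pr.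
rewrite lognt_nth // ltnNge leq_addr addKn logn_prod //=.
have powE p : p \in primes (\prod_(b <- ms) b) ->
    logn q (p ^ nth 0 (sort leq [seq logn p b | b <- ms]) i) =
    (if p == q then nth 0 (sort leq [seq logn q b | b <- ms]) i else 0)%N.
  rewrite mem_primes => /andP[p_pr _]; rewrite lognX logn_prime // eq_sym.
  by case: eqP => [-> | _]; rewrite ?muln1 ?muln0.
rewrite (eq_big_seq _ powE) -big_mkcond /=.
have [q_ms | q_nms] := boolP (q \in primes (\prod_(b <- ms) b)).
  by rewrite -big_filter filter_pred1_uniq ?primes_uniq // big_seq1.
rewrite big1_seq => [|p /andP[/eqP-> q_ms]]; last by rewrite q_ms in q_nms.
have : nth 0%N (sort leq [seq logn q b | b <- ms]) i \in [seq logn q b | b <- ms].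
  by rewrite -(mem_sort leq) mem_nth // size_sort size_map.
case/mapP => b ms_b ->; apply/eqP; rewrite -leqn0 leqNgt logn_gt0.
apply: contra q_nms; rewrite !mem_primes => /and3P[_ _ q_b].
have ms_prod_gt0 : (0 < \prod_(b <- ms) b)%N by rewrite big_seq prodn_cond_gt0.
by rewrite q_pr ms_prod_gt0 (big_rem b) //= dvdn_mulr.
Qed.

(** * The torsion of the cokernel *)

(** Lets congruences of integers be checked in the ring ['Z_m], where canonical
    representatives can be replaced by the residues they represent. *)
Lemma intr_eq0_Zp m (z : int) :
  (1 < m)%N -> (z%:~R == 0 :> 'Z_m) = (z \in dvdz m).
Proof.
case: m => [|[|m]] // _.
have natE a : (a%:R == 0 :> 'Z_m.+2) = (m.+2 %| a)%N by rewrite Zp_nat -val_eqE.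
case: z => a; first exact: natE.
by rewrite NegzE rmorphN oppr_eq0 natE dvdzE abszN.
Qed.

Lemma nat_Zp_intr m (x : 'Z_m) : (x : nat)%:Z%:~R = x.
Proof. exact: natr_Zp. Qed.

(** In the coordinates [y] given by the adapted basis, a vector is in [M] iff each
    [y_i] is a multiple of the weight [w_i].  Listing the nontrivial entries
    first, then the ones, then the zero weights, the isomorphism lifts the
    residues to the first coordinates and sets the others to zero.  A class is
    torsion iff its coordinates of weight zero vanish, and coordinates of weight 1
    can be changed at will, so every torsion class is reached. *)
Lemma coker_torsion_presentation n (M : zmodClosed 'rV[int]_n) s :
  diagonal_presentation M s -> coker_torsion_iso M (nontrivial s).
Proof.
move=> sM; have [_ s_gt0 _] := (diagonal_presentationP _ _).1 sM.
have := perm_nontrivial s_gt0; set t := nontrivial s; set c := count _ s.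
rewrite perm_sym perm_catC perm_sym => /perm_diagonal_presentation/(_ sM).
case/diagonal_presentationP; rewrite size_cat size_nseq => le_tn _ [R uR defM].
set w := (fun i : 'I_n => _) in defM.
have t_gt1 (j : 'I_(size t)) : (1 < nth 0 t j)%N.
  by have : nth 0%N t j \in t by [apply: mem_nth]; rewrite mem_filter => /andP[].
have wT (i : 'I_n) (j : 'I_(size t)) : i = j :> nat -> w i = nth 0%N t j.
  by rewrite /w => ->; rewrite nth_cat ltn_ord.
have memM v : (v *m R \in M) = [forall i, v 0 i \in dvdz (w i)].
  by rewrite defM mem_weight_lattice // mulmxK.
pose lift (u : {dffun forall i : 'I_(size t), 'Z_(nth 0%N t i)}) : 'rV[int]_n :=
  \row_i (if insub (i : nat) is Some j then (u j : nat)%:Z else 0).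
have liftE u (i : 'I_n) (j : 'I_(size t)) : i = j :> nat -> lift u 0 i = (u j : nat)%:Z.
  by move=> eq_ij; rewrite mxE eq_ij valK.
have lift0 u (i : 'I_n) : (size t <= i)%N -> lift u 0 i = 0.
  by move=> le_ti; rewrite mxE insubF // ltnNge le_ti.
move: lift liftE lift0 => lift liftE lift0.
pose f u : {ideal_quot M} := (\pi_({ideal_quot M}) (lift u *m R))%qT.
have eq_pi x y : (\pi_({ideal_quot M}) (x *m R) = \pi_({ideal_quot M}) (y *m R))%qT <->
    forall i, (x - y) 0 i \in dvdz (w i).
  split=> [/eqP | xy].
    by rewrite -Quotient.idealrBE -mulmxBl memM => /forallP.
  by apply/eqP; rewrite -Quotient.idealrBE -mulmxBl memM; apply/forallP.
exists f; split=> [u v | u v | x].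
- rewrite /f -raddfD -mulmxDl; apply/eq_pi => i; rewrite !mxE.
  have [lt_it | le_ti] := ltnP i (size t); last first.
    by rewrite !lift0 // subr0 rpred0.
  rewrite !(liftE _ _ (Ordinal lt_it)) // (wT _ (Ordinal lt_it)) //.
  rewrite -intr_eq0_Zp // intrB intrD !nat_Zp_intr ffunE.
  by rewrite subrr.
- move/eq_pi => uv; apply/ffunP => j.
  have lt_jn : (j < n)%N.
    by rewrite (leq_trans (ltn_ord j)) // (leq_trans _ le_tn) ?leq_addr.
  have := uv (Ordinal lt_jn); rewrite !mxE !(liftE _ _ j) // (wT _ j) //.
  by rewrite -intr_eq0_Zp // intrB !nat_Zp_intr subr_eq0 => /eqP.
have mulRn y k : (y *m R) *+ k = (y *+ k) *m R.
  by rewrite -!scaler_nat scalemxAl.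
have pi0 : (\pi_({ideal_quot M}) (0 *m R))%qT = 0 by rewrite mul0mx raddf0.
split=> [[u <-] | [k k_gt0]].
  exists (\prod_(a <- t) a)%N.
    by rewrite big_seq prodn_cond_gt0 // => a; rewrite mem_filter => /andP[/ltnW].
  rewrite /f -raddfMn mulRn -pi0; apply/eq_pi => i.
  rewrite subr0 mulmxnE -mulr_natl natz.
  have [lt_it | le_ti] := ltnP i (size t); last by rewrite lift0 // mulr0 rpred0.
  rewrite (wT _ (Ordinal lt_it)) // dvdz_mulr //.
  by rewrite dvdzE /= (big_nth 0%N) big_mkord (bigD1 (Ordinal lt_it)) //= dvdn_mulr.
have [y ->] : exists y, x = \pi_({ideal_quot M})%qT (y *m R).
  by exists (generic_quotient.repr x *m invmx R); rewrite mulmxKV // reprK.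
rewrite -raddfMn mulRn -pi0 => /eq_pi ky0.
exists [ffun j : 'I_(size t) => (y 0 (widen_ord (leq_trans (leq_addr c _) le_tn) j))%:~R].
apply/eq_pi => i; rewrite !mxE.
have [lt_it | le_ti] := ltnP i (size t).
  rewrite (liftE _ _ (Ordinal lt_it)) // (wT _ (Ordinal lt_it)) //.
  rewrite -intr_eq0_Zp // intrB nat_Zp_intr ffunE.
  by rewrite (_ : widen_ord _ _ = i) ?subrr //; apply: val_inj.
have := ky0 i; rewrite lift0 // sub0r rpredN subr0 mulmxnE /w nth_cat.
rewrite ltnNge le_ti /= nth_nseq; case: ifP => _; first by rewrite !dvd1z.
by rewrite !dvd0z -mulr_natl mulf_eq0 pnatr_eq0 eqn0Ngt k_gt0.
Qed.

(** * Lattices of row differences *)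

(** A basis (the rows of [R]) in which the row lattice of [P] is diagonal, with
    one distinguished basis vector, of weight 1, and all others in the hyperplane
    where coordinate [h] vanishes. *)
Definition pointed_weights n (P : 'M[int]_n) (h : 'I_n) (w : 'I_n -> nat)
    (i0 : 'I_n) : Prop :=
  exists R : 'M[int]_n,
    [/\ R \in unitmx, forall i, R i h = (i == i0)%:R, w i0 = 1%N &
        row_lattice P =i row_lattice (weight_mx w *m R)].

(** Coordinate [h] of a vector of the row lattice is its coefficient at [i0], so
    cutting by the hyperplane replaces the weight 1 at [i0] by 0. *)
Lemma pointed_hyperplane n (M : zmodClosed 'rV[int]_n) (P : 'M[int]_n) h w i0 s :
  (forall v, (v \in M) = (v \in row_lattice P) && (v 0 h == 0)) ->
  pointed_weights P h w i0 ->
  perm_eq (1%N :: s) [seq a <- codom w | (0 < a)%N] ->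
  diagonal_presentation M s.
Proof.
move=> defM [R [uR Rh w1 defP]] eq_s.
pose w' i := if i == i0 then 0%N else w i.
apply: (@has_weights_presentation _ _ w').
  exists R => // v; rewrite defM defP.
  apply/andP/row_latticeP => [[/row_latticeP[u def_v] vh0] | [u ->]].
    have u0 : u 0 i0 = 0.
      move: vh0; rewrite def_v mulmxA mxE (bigD1 i0) //= big1 => [|i].
        by rewrite Rh eqxx row_mul_weight_mx w1 addr0 !mulr1 => /eqP.
      by rewrite Rh => /negPf->; rewrite mulr0.
    exists u; rewrite def_v !mulmxA; congr (_ *m R); apply/rowP => i.
    rewrite !row_mul_weight_mx /w'; case: eqP => // ->.
    by rewrite u0 !mul0r.
  split.
    apply/row_latticeP; exists (\row_i (u 0 i *+ (i != i0))).
    rewrite !mulmxA; congr (_ *m R); apply/rowP => i.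
    by rewrite !row_mul_weight_mx mxE /w'; case: eqP; rewrite ?mulr0 ?mul0r.
  rewrite mulmxA mxE big1 // => i _; rewrite Rh row_mul_weight_mx /w'.
  by case: eqP; rewrite ?mulr0 ?mul0r.
set r := rem i0 (enum 'I_n).
have eq_enum : perm_eq (enum 'I_n) (i0 :: r) by rewrite perm_to_rem ?mem_enum.
have eq_w : perm_eq [seq a <- codom w | (0 < a)%N]
                    (1%N :: [seq a <- map w r | (0 < a)%N]).
  by rewrite codomE (permPl (perm_filter _ (perm_map w eq_enum))) /= w1.
have eq_w' : perm_eq [seq a <- codom w' | (0 < a)%N] [seq a <- map w r | (0 < a)%N].
  rewrite codomE (permPl (perm_filter _ (perm_map w' eq_enum))) /= {1}/w' eqxx /=.
  rewrite (_ : map w' r = map w r) //; apply/eq_in_map => i.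
  by rewrite mem_rem_uniq ?enum_uniq // inE /w'; case: eqP.
by rewrite -(perm_cons 1%N) (permPl eq_s) (permPl eq_w) perm_cons perm_sym.
Qed.

Lemma row_lattice_tens n m (A A' : 'M[int]_n) (B B' : 'M[int]_m) :
  row_lattice A =i row_lattice A' -> row_lattice B =i row_lattice B' ->
  row_lattice (A *t B) =i row_lattice (A' *t B').
Proof.
case/row_lattice_eqP=> -[X ->] [Y eqY] /row_lattice_eqP[[Z ->] [T eqT]].
apply/row_lattice_eqP; split; first by exists (X *t Z); rewrite tensmx_mul.
by exists (Y *t T); rewrite tensmx_mul -eqY -eqT.
Qed.

Lemma tens_weight_mx n m (w : 'I_n -> nat) (w' : 'I_m -> nat) :
  weight_mx w *t weight_mx w' =
  weight_mx (fun k => w (mxtens_unindex k).1 * w' (mxtens_unindex k).2)%N.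
Proof.
apply/matrixP => k l; case: (mxtens_indexP k) => i j.
case: (mxtens_indexP l) => i' j'.
rewrite tensmxE !mxE mxtens_indexK (can_eq (@mxtens_indexK _ _)) xpair_eqE.
by case: (i == i'); case: (j == j'); rewrite ?mulr0 ?mul0r.
Qed.

Lemma tens_unitmx n m (A : 'M[int]_n) (B : 'M[int]_m) :
  A \in unitmx -> B \in unitmx -> A *t B \in unitmx.
Proof.
move=> uA uB; have : (A *t B) *m (invmx A *t invmx B) = 1%:M.
  rewrite tensmx_mul !mulmxV //; apply/matrixP => k l.
  case: (mxtens_indexP k) => i j; case: (mxtens_indexP l) => i' j'.
  rewrite tensmxE !mxE (can_eq (@mxtens_indexK _ _)) xpair_eqE.
  by case: (i == i'); case: (j == j').
by case/mulmx1_unit.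
Qed.

(** The distinguished basis vector is the tensor product of the distinguished
    ones: coordinate [(h, h')] of a tensor product is the product of coordinates,
    which vanishes unless both factors are distinguished. *)
Lemma pointed_tens n m (P : 'M[int]_n) (Q : 'M[int]_m) h h' w w' i0 j0 :
  pointed_weights P h w i0 -> pointed_weights Q h' w' j0 ->
  pointed_weights (P *t Q) (mxtens_index (h, h'))
    (fun k => w (mxtens_unindex k).1 * w' (mxtens_unindex k).2)%N
    (mxtens_index (i0, j0)).
Proof.
case=> R [uR Rh w1 defP] [R' [uR' Rh' w1' defQ]].
exists (R *t R'); split; first exact: tens_unitmx.
- move=> k; case: (mxtens_indexP k) => i j; rewrite tensmxE Rh Rh'.
  rewrite (can_eq (@mxtens_indexK _ _)) xpair_eqE.
  by case: (i == i0); case: (j == j0); rewrite ?mulr0 ?mul0r.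
- by rewrite mxtens_indexK /= w1 w1'.
by move=> v; rewrite (row_lattice_tens defP defQ) -tensmx_mul tens_weight_mx.
Qed.

(** The rows and the columns of the commuting matrix of a product group are
    enumerated in another order than those of the Kronecker product. *)
Lemma pointed_reindex N n (f : 'I_N -> 'I_n) (T : 'M[int]_n) h w i0 :
  bijective f -> pointed_weights T (f h) w i0 ->
  exists w' i1, pointed_weights (mxsub f f T) h w' i1 /\ perm_eq (codom w') (codom w).
Proof.
move=> bij_f; have eqN : N = n by rewrite -[N]card_ord -[n]card_ord (bij_eq_card bij_f).
case: n / eqN in f T w i0 bij_f * => -[R [uR Rh w1 defT]].
exists w, i0; split=> //; pose s := perm (bij_inj bij_f).
have -> : mxsub f f T = perm_mx s *m col_perm s T.
  by rewrite -row_permE; apply/matrixP => i j; rewrite !mxE !permE.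
exists (col_perm s R); split=> //.
- by rewrite col_permE unitmx_mul unitmx_perm uR.
- by move=> i; rewrite mxE permE.
move=> v; rewrite (row_lattice_unitl _ (unitmx_perm _ s)) !col_permE mulmxA.
exact: row_lattice_mulr.
Qed.

(** Write [T = (1 | B)] with first row [(1 | p)].  Subtracting the first row from
    all rows gives [(0 | C)], and a basis adapted to the row lattice of [C],
    together with the first row of [T], is adapted to that of [T].  As the first
    row has weight 1, the weights are 1 and the invariant factors of [C]. *)
Lemma pointed_weights_exist_ord0 n (T : 'M[int]_(1 + n)) :
  (forall i, T i 0 = 1) ->
  exists w s, [/\ pointed_weights T 0 w 0, 
    perm_eq (1%N :: s) [seq a <- codom w | (0 < a)%N],
    sorted dvdn s & all (fun a => 0 < a)%N s].
Proof.
move=> T1; pose B := rsubmx T; pose e : 'rV[int]_(1 + n) := delta_mx 0 0.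
pose one : 'cV[int]_(1 + n) := const_mx 1.
have defT : T = row_mx one B.
  rewrite -[LHS]hsubmxK; congr row_mx; apply/colP => i; rewrite !mxE.
  by rewrite -[RHS](T1 i); congr (T i _); apply: val_inj.
pose p := e *m B; pose C := B - one *m p.
have [s [sC s_sorted]] := invariant_factors_exist C.
have [le_sn s_gt0 [R1 uR1 /row_lattice_eqP[[X defX] [Y defY]]]] :=
  (diagonal_presentationP _ _).1 sC.
set W1 := weight_mx _ in defX defY.
pose w (i : 'I_(1 + n)) := nth 0%N (1%N :: s) i.
exists w, s; split=> //; last first.
  by rewrite codom_nth_pad //= filter_cat filter_nseq cats0 (all_filterP s_gt0).
pose R := block_mx (1%:M : 'M[int]_1) p 0 R1.
have defW : weight_mx w = block_mx 1%:M 0 0 W1.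
  apply/matrixP => i j; rewrite -[i]splitK -[j]splitK.
  case: (split i) => i'; case: (split j) => j' /=.
  - by rewrite block_mxEul !mxE [i']ord1 [j']ord1.
  - by rewrite block_mxEur !mxE [i']ord1.
  - by rewrite block_mxEdl !mxE [j']ord1.
  by rewrite block_mxEdr !mxE (inj_eq (@rshift_inj _ _)).
exists R; split=> //.
- by rewrite unitmxE det_ublock det1 mul1r -unitmxE.
- have -> : 0 = lshift n 0 :> 'I_(1 + n) by apply: val_inj.
  move=> i; rewrite -[i]splitK; case: (split i) => i' /=.
    by rewrite block_mxEul !mxE [i']ord1 !eqxx.
  by rewrite block_mxEdl mxE.
apply/row_lattice_eqP; rewrite defW mulmx_block !mul1mx !mul0mx !mulmx0 !addr0 add0r.
split.
  exists (row_mx one X); rewrite mul_row_block !mulmx1 !mulmx0 addr0 -defX defT.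
  by rewrite /C addrC subrK.
(* e *m T is the first row of T, and (Y - Y *m one *m e) *m T = Y *m (0 | C). *)
exists (col_mx e (Y - Y *m one *m e)); 
have e1 : e *m one = 1%:M.
  by apply/rowP => j; rewrite -rowE !mxE [j]ord1.
have eT : e *m T = row_mx 1%:M p by rewrite defT mul_mx_row e1.
rewrite mul_col_mx eT mulmxBl -!mulmxA eT -mulmxBr mul_mx_row mulmx1.
by rewrite [in T - _]defT opp_row_mx add_row_mx subrr mul_mx_row mulmx0 -defY.
Qed.

Lemma pointed_weights_exist n (P : 'M[int]_n) h :
  (forall i, P i h = 1) ->
  exists w i0 s, [/\ pointed_weights P h w i0,
    perm_eq (1%N :: s) [seq a <- codom w | (0 < a)%N],
    sorted dvdn s & all (fun a => 0 < a)%N s].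
Proof.
case: n => [|n] in P h *; first by case: h.
move=> P1; pose f := tperm ord0 h.
pose T : 'M_n.+1 := mxsub f f P.
have [i|w [s [T_w w_s s_sorted s_gt0]]] := @pointed_weights_exist_ord0 n T.
  by rewrite mxE tpermL P1.
have bij_f : bijective f by exists f; apply: tpermK.
have [|w' [i1 [P_w' w'_w]]] := @pointed_reindex _ _ f T h w ord0 bij_f.
  by rewrite tpermR.
exists w', i1, s; split=> //.
  have <- : mxsub f f T = P by apply/matrixP => i j; rewrite !mxE !tpermK.
  by [].
by rewrite (permPl w_s) perm_sym perm_filter.
Qed.

(** * Commuting lattices *)

(** A combination of rows has as coordinate at the identity the sum of its
    coefficients; if this sum is zero, subtracting the row of the identity from
    each row does not change the combination. *)
Lemma mem_comm_lattice (gT : finGroupType) (v : 'rV[int]_#|gT|) :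
  (v \in comm_lattice gT) =
  (v \in row_lattice (commuting_mx gT)) && (v 0 (enum_rank 1%g) == 0).
Proof.
set h := enum_rank _.
have P1 i : commuting_mx gT i h = 1 by rewrite mxE enum_rankK mulg1 mul1g eqxx.
apply/idP/andP => [/row_latticeP[u ->] | [/row_latticeP[u ->] /eqP u0]].
  split.
    rewrite mulmx_sum_row rpred_sum // => k _; rewrite rowK scalerBr.
    by apply/row_latticeP; exists (u 0 k *: (delta_mx 0 (enum_rank (enum_val k).1)
      - delta_mx 0 (enum_rank (enum_val k).2))); rewrite -scalemxAl mulmxBl -!rowE scalerBr.
  by rewrite mxE big1 // => k _; rewrite !mxE !enum_rankK !mulg1 !mul1g !eqxx
    subrr mulr0.
have -> : u *m commuting_mx gT =
    \sum_i u 0 i *: (row i (commuting_mx gT) - row h (commuting_mx gT)).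
  under eq_bigr do rewrite scalerBr; rewrite sumrB -scaler_suml mulmx_sum_row.
  have -> : \sum_i u 0 i = 0.
    by rewrite -[RHS]u0 mxE; apply: eq_bigr => i _; rewrite P1 mulr1.
  by rewrite scale0r subr0.
apply: rpred_sum => i _.
have -> : row i (commuting_mx gT) - row h (commuting_mx gT) =
    row (enum_rank (enum_val i, 1%g)) (comm_diff_mx gT).
  by rewrite rowK !enum_rankK /= enum_valK.
by apply/row_latticeP; exists (u 0 i *: delta_mx 0 (enum_rank (enum_val i, 1%g)));
  rewrite -scalemxAl -rowE.
Qed.

(** The construction of a pointed basis produces invariant factors of its own; they
    are the given ones by uniqueness. *)
Lemma comm_pointed (gT : finGroupType) d :
  invariant_factors (comm_lattice gT) d ->
  exists w i0, pointed_weights (commuting_mx gT) (enum_rank 1%g) w i0 /\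
    perm_eq (1%N :: d) [seq a <- codom w | (0 < a)%N].
Proof.
move=> dM; have [i|w [i0 [s [P_w w_s s_sorted s_gt0]]]] :=
  @pointed_weights_exist _ (commuting_mx gT) (enum_rank 1%g).
  by rewrite mxE enum_rankK mulg1 mul1g eqxx.
have sM : invariant_factors (comm_lattice gT) s.
  by split=> //; apply: pointed_hyperplane P_w w_s; apply: mem_comm_lattice.
by exists w, i0; rewrite (invariant_factors_uniq dM sM).
Qed.

Lemma filter_pos_mul (s t : seq nat) :
  [seq a <- [seq (i * j)%N | i <- s, j <- t] | (0 < a)%N] =
  [seq (i * j)%N | i <- [seq a <- s | (0 < a)%N], j <- [seq a <- t | (0 < a)%N]].
Proof.
elim: s => //= i s IHs; rewrite filter_cat IHs.
have -> : [seq a <- [seq (i * j)%N | j <- t] | (0 < a)%N] =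
    if (0 < i)%N then [seq (i * j)%N | j <- [seq a <- t | (0 < a)%N]] else [::].
  elim: t {IHs} => /= [|j t ->]; first by case: ifP.
  by rewrite muln_gt0; case: (0 < i)%N => //=; case: ifP.
by case: ifP.
Qed.

Lemma perm_codom_tens n m (w : 'I_n -> nat) (w' : 'I_m -> nat) :
  perm_eq (codom (fun k : 'I_(n * m) =>
                    w (mxtens_unindex k).1 * w' (mxtens_unindex k).2)%N)
          [seq (i * j)%N | i <- codom w, j <- codom w'].
Proof.
rewrite !codomE allpairs_mapl allpairs_mapr.
have eq_enum : perm_eq (enum 'I_(n * m))
    [seq mxtens_index (i, j) | i <- enum 'I_n, j <- enum 'I_m].
  apply: uniq_perm; rewrite ?enum_uniq //.
    apply: allpairs_uniq; rewrite ?enum_uniq // => -[i j] [k l] _ _ /=.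
    by move/(can_inj (@mxtens_indexK _ _)).
  move=> k; rewrite mem_enum inE; case: (mxtens_indexP k) => i j; apply/esym/allpairsP.
  by exists (i, j); rewrite !mem_enum.
rewrite (permPl (perm_map _ eq_enum)) map_allpairs.
by under eq_map => i do under eq_map => j do rewrite mxtens_indexK /=.
Qed.

Lemma commuting_mx_prod (gT hT : finGroupType) :
  let f (k : 'I_#|{: gT * hT}|) :=
    mxtens_index (enum_rank (enum_val k).1, enum_rank (enum_val k).2) in
  commuting_mx (gT * hT)%type = mxsub f f (commuting_mx gT *t commuting_mx hT).
Proof.
move=> f; apply/matrixP => k l; rewrite [RHS]mxE tensmxE !mxE !enum_rankK.
case: (enum_val k) (enum_val l) => [g h] [g' h'].
rewrite -natrM mulnb; congr (nat_of_bool _)%:R.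
Qed.

(** The positive weights are the products of the lists [1 :: d] and [1 :: e], from
    which the hyperplane removes the product [1 * 1]. *)
Lemma comm_lattice_prod (gT hT : finGroupType) d e :
  invariant_factors (comm_lattice gT) d -> invariant_factors (comm_lattice hT) e ->
  diagonal_presentation (comm_lattice (gT * hT)%type)
    (d ++ e ++ [seq (i * j)%N | i <- d, j <- e]).
Proof.
move=> /comm_pointed[w [i0 [P_w w_d]]] /comm_pointed[w' [j0 [P_w' w'_e]]].
have := pointed_tens P_w P_w'; set W := fun k => _; set k0 := mxtens_index (i0, j0).
pose f (k : 'I_#|{: gT * hT}|) :=
  mxtens_index (enum_rank (enum_val k).1, enum_rank (enum_val k).2).
have bij_f : bijective f.
  exists (fun k => enum_rank (enum_val (mxtens_unindex k).1,
                              enum_val (mxtens_unindex k).2)) => k.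
    by rewrite mxtens_indexK /= !enum_rankK -surjective_pairing enum_valK.
  by rewrite /f !enum_rankK !enum_valK -surjective_pairing mxtens_unindexK.
have -> : mxtens_index (enum_rank 1%g, enum_rank 1%g) = f (enum_rank 1%g).
  by rewrite /f enum_rankK.
move=> P_W; have [v [k1 [P_v v_W]]] := pointed_reindex bij_f P_W.
apply: pointed_hyperplane P_v _.
  by rewrite -commuting_mx_prod; apply: mem_comm_lattice.
rewrite perm_sym (permPl (perm_filter _ v_W)).
rewrite (permPl (perm_filter _ (perm_codom_tens w w'))) filter_pos_mul.
rewrite perm_sym; apply: perm_trans (perm_allpairs _ w_d w'_e); rewrite /= perm_cons.
rewrite (eq_map mul1n) map_id perm_catCA perm_cat2l perm_sym.
by rewrite perm_allpairs_consr (eq_map muln1) map_id.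
Qed.

(** The rank drops modulo [p] iff some nonzero diagonal entry vanishes there. *)
Lemma comm_conductorE (gT : finGroupType) s p :
  diagonal_presentation (comm_lattice gT) s ->
  (p \in comm_conductor gT) = prime p && has (dvdn p) s.
Proof.
case/diagonal_presentationP=> le_s s_gt0 sM; rewrite inE; case p_pr: (prime p) => //=.
rewrite !(rank_over_seq _ le_s sM).
have -> : count (fun a => a%:R != 0 :> rat) s = size s.
  rewrite -[RHS](count_predT s); apply/eq_in_count => a /(allP s_gt0).
  by rewrite pnatr_eq0 lt0n => ->.
rewrite ltn_neqAle count_size andbT -all_count -has_predC; apply: eq_has => a /=.
by rewrite negbK (dvdn_pcharf (pchar_Fp p_pr)).
Qed.

Theorem theorem4p6 (gT hT : finGroupType) (d e : seq nat) :
  invariant_factors (comm_lattice gT) d ->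
  invariant_factors (comm_lattice hT) e ->
  let M := comm_lattice (gT * hT)%type in
  let de := [seq (i * j)%N | i <- d, j <- e] in
  let ms := nontrivial d ++ nontrivial e ++ nontrivial de in
  [/\ diagonal_presentation M (d ++ e ++ de),
      perm_eq (nontrivial (d ++ e ++ de)) ms,
      coker_torsion_iso M (regroup ms),
      (forall t : seq nat, smith_spectrum M t <-> t = regroup ms) &
      comm_conductor (gT * hT)%type
        =i [predU comm_conductor gT & comm_conductor hT]].
Proof.
move=> dG eH M de ms; have sM := comm_lattice_prod dG eH.
have eq_ms : nontrivial (d ++ e ++ de) = ms by rewrite /nontrivial !filter_cat.
have ms_perm : perm_eq ms (nontrivial (d ++ e ++ de)) by rewrite eq_ms.
have [t tM] := invariant_factors_exist (comm_diff_mx (gT * hT)%type).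
have def_t := nontrivial_invariant_factors sM tM ms_perm.
split=> //.
- by rewrite perm_sym.
- by rewrite -def_t; apply: coker_torsion_presentation tM.1.
- move=> r; split=> [[s s_inv ->] | ->]; last by exists t.
  exact: nontrivial_invariant_factors sM s_inv ms_perm.
move=> p; transitivity ((p \in comm_conductor gT) || (p \in comm_conductor hT)); last by [].
rewrite (comm_conductorE _ sM).
rewrite (comm_conductorE _ dG.1) (comm_conductorE _ eH.1) -andb_orr.
case p_pr: (prime p) => //=; rewrite !has_cat orbA.
apply/orb_idr => /hasP[_ /allpairsP[[a b] [/= da eb ->]]].
rewrite Euclid_dvdM // => /orP[p_a | p_b]; apply/orP.
  by left; apply/hasP; exists a.
by right; apply/hasP; exists b.
Qed.
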